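(* Let $\mathfrak{g}$ be a real Lie algebra of dimension seven with non-trivial center, and let $\varphi\in\Lambda^3(\mathfrak{g}^* )$ be a $3$-form defining a coclosed $\mathrm{G}_2$-structure on $\mathfrak{g}$. If $\pi:\mathfrak{g}\to\mathfrak{h}$ is a Lie algebra epimorphism from $\mathfrak{g}$ onto a six-dimensional Lie algebra $\mathfrak{h}$, with kernel contained in the center of $\mathfrak{g}$, then $\varphi$ determines (in the sense explained in the context) an $\mathrm{SU}(3)$-structure $(\omega,\psi_-)$ on $\mathfrak{h}$ such that the $3$-form $\psi_-$ is closed.
   Context: $d$ denotes the Chevalley–Eilenberg differential of a Lie algebra, and $e^{ijk}=e^i\wedge e^j\wedge e^k$, etc. A $\mathrm{G}_2$-structure on a $7$-dimensional real Lie algebra $\mathfrak{g}$ is a $3$-form $\varphi\in\Lambda^3(\mathfrak{g}^* )$ that is positive, i.e. there is a coframe $\{e^1,\dots,e^7\}$ of $\mathfrak{g}^*$ with $\varphi=e^{127}+e^{347}+e^{567}+e^{135}-e^{146}-e^{236}-e^{245}$. Such a $\varphi$ determines the inner product $g_\varphi$ for which $\{e^i\}$ is orthonormal and the orientation $e^{1\cdots7}$ (both independent of the choice of such a coframe); its Hodge dual $4$-form is $\phi=\star_\varphi\varphi=e^{1234}+e^{1256}+e^{1367}+e^{1457}+e^{2357}-e^{2467}+e^{3456}$. The $\mathrm{G}_2$-structure is coclosed if $d\phi=0$. An $\mathrm{SU}(3)$-structure on a $6$-dimensional real vector space $V$ can be described by a pair $(\omega,\psi_-)\in\Lambda^2(V^*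 )\times\Lambda^3(V^* )$ for which there is a coframe $\{f^1,\dots,f^6\}$ of $V^*$ with $\omega=f^{12}+f^{34}+f^{56}$ and $\psi_-=-f^{246}+f^{136}+f^{145}+f^{235}$ (here $\psi_-$ is the imaginary part of the complex volume form). Meaning of ''determines'': if $X\in\mathfrak{g}$ is a unit vector for $g_\varphi$, then on the $g_\varphi$-orthogonal complement $X^\perp$ the pair given by the restrictions of $\iota_X\varphi$ and $-\iota_X\phi$ is an $\mathrm{SU}(3)$-structure. Taking $X$ to be a unit vector spanning $\ker\pi$, the $\mathrm{SU}(3)$-structure $(\omega,\psi_-)$ on $\mathfrak{h}$ is the one obtained by transporting this structure through the linear isomorphism $\pi|_{X^\perp}:X^\perp\to\mathfrak{h}$. *)

(* Defs.v *)
From mathcomp Require Import all_boot all_order all_algebra.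
From mathcomp Require Import all_classical all_reals.

Set Implicit Arguments.
Unset Strict Implicit.
Unset Printing Implicit Defensive.

Import Order.TTheory GRing.Theory Num.Theory.
Local Open Scope classical_set_scope.
Local Open Scope ring_scope.

Section Lie.
Variables (R : realType) (V W : vectType R).

Definition is_lie_bracket (br : V -> V -> V) : Prop :=
  [/\ forall x, linear (br x),
      forall y, linear (br^~ y),
      forall x, br x x = 0 &
      forall x y z, br x (br y z) + br y (br z x) + br z (br x y) = 0].

Definition lie_central (br : V -> V -> V) (z : V) : Prop :=
  forall x, br z x = 0.

Definition is_lie_hom (brV : V -> V -> V) (brW : W -> W -> W)
    (f : 'Hom(V, W)) : Prop :=
  forall x y, f (brV x y) = brW (f x) (f y).

End Lie.

(* A k-form on V is represented by its values on k-tuples of vectors; forms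
   are added pointwise. *)
Section Forms.
Variable R : realType.

Definition is_form (V : vectType R) (k : nat) (a : k.-tuple V -> R) : Prop :=
  (forall (v : k.-tuple V) (i : 'I_k),
      scalar (fun x : V =>
        a [tuple if j == i then x else tnth v j | j < k])) /\
  (forall (v : k.-tuple V) (i j : 'I_k),
      i != j -> tnth v i = tnth v j -> a v = 0).

Definition pullback (V W : vectType R) (f : W -> V) (k : nat)
    (a : k.-tuple V -> R) : k.-tuple W -> R :=
  fun v => a (map_tuple f v).

Definition contract (V : vectType R) (X : V) (k : nat)
    (a : k.+1.-tuple V -> R) : k.-tuple V -> R :=
  fun v => a [tuple of X :: v].

(* The Chevalley-Eilenberg differential of a form of positive degree,
     (da)(x_0, ..., x_{k+1})
       = \sum_(p < q) (-1)^(p+q) a([x_p, x_q], x_0, .., ^x_p, .., ^x_q, ..).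
   The index p is represented by i : 'I_k.+1; as i < j, the ordinal lift j i
   has value i, and m |-> lift j (lift i m) enumerates in increasing order the
   indices other than i and j. *)
Definition ce_diff (V : vectType R) (br : V -> V -> V) (k : nat)
    (a : k.+1.-tuple V -> R) : k.+2.-tuple V -> R :=
  fun v =>
    \sum_(j < k.+2) \sum_(i < k.+1 | (i < j)%N)
      (-1) ^+ (i + j) *
      a [tuple of br (tnth v (lift j i)) (tnth v j)
                  :: [tuple tnth v (lift j (lift i m)) | m < k]].

(* e^{i_1} /\ ... /\ e^{i_k}, for 1-based indices i_1, ..., i_k, normalised by
   (e^1 /\ ... /\ e^k)(v_1, ..., v_k) = det (e^i (v_j)). *)
Definition ewedge (V : vectType R) (e : seq 'Hom(V, R^o)) (k : nat)
    (I : k.-tuple nat) : k.-tuple V -> R :=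
  fun v => \det (\matrix_(i < k, j < k) (e`_(tnth I i).-1 (tnth v j) : R)).

Definition is_coframe (V : vectType R) (n : nat)
    (e : n.-tuple 'Hom(V, R^o)) : Prop :=
  basis_of fullv e.

(* When e is a coframe, the linear map x |-> (e^j(x))_j is bijective, so its
   lfun inverse is two-sided and the dual frame satisfies e^j(E_i) = delta_ij. *)
Definition dual_frame (V : vectType R) (n : nat)
    (e : n.-tuple 'Hom(V, R^o)) (i : 'I_n) : V :=
  ((linfun (fun x : V => \row_(j < n) (tnth e j x : R)))^-1)%VF
    (delta_mx 0 i).

Definition volume (V : vectType R) (n : nat)
    (e : n.-tuple 'Hom(V, R^o)) : n.-tuple V -> R :=
  ewedge e [tuple i.+1 | i < n].

Definition increasing (k n : nat) (s : {ffun 'I_k -> 'I_n}) : bool :=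
  [forall i : 'I_k, forall j : 'I_k, (i < j)%N ==> (s i < s j)%N].

(* The Hodge star for the metric and the orientation in which the coframe e is
   orthonormal and positive:
     *a = \sum_I a(E_I) * iota_(E_I) (e^{1...n}), E the dual frame,
   so that e^I /\ *e^I = e^{1...n} for every increasing multi-index I. *)
Definition hodge (V : vectType R) (k m : nat)
    (e : (k + m).-tuple 'Hom(V, R^o)) (a : k.-tuple V -> R) :
    m.-tuple V -> R :=
  fun v =>
    \sum_(s : {ffun 'I_k -> 'I_(k + m)} | increasing s)
      let Es := [tuple dual_frame e (s i) | i < k] in
      a Es * volume e [tuple of Es ++ v].

End Forms.

Section G2.
Variables (R : realType) (V : vectType R).
Implicit Types (phi : 3.-tuple V -> R) (e : 7.-tuple 'Hom(V, R^o)).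

Definition g2_adapted phi e : Prop :=
  is_coframe e /\
  phi = ewedge e [tuple 1; 2; 7]%N + ewedge e [tuple 3; 4; 7]%N
      + ewedge e [tuple 5; 6; 7]%N + ewedge e [tuple 1; 3; 5]%N
      - ewedge e [tuple 1; 4; 6]%N - ewedge e [tuple 2; 3; 6]%N
      - ewedge e [tuple 2; 4; 5]%N.

Definition g2_structure phi : Prop :=
  is_form phi /\ exists e, g2_adapted phi e.

(* The metric, the orientation and the Hodge star of a G2-structure do not
   depend on the adapted coframe, so we let phi pick one. *)
Definition g2_coframe phi : 7.-tuple 'Hom(V, R^o) :=
  xget [tuple 0 | _ < 7] [set e | g2_adapted phi e].

Definition g2_metric phi (x y : V) : R :=
  \sum_(i < 7) (tnth (g2_coframe phi) i x : R) * tnth (g2_coframe phi) i y.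

Definition g2_star phi : 4.-tuple V -> R :=
  @hodge R V 3 4 (g2_coframe phi) phi.

Definition g2_coclosed (br : V -> V -> V) phi : Prop :=
  ce_diff br (g2_star phi) = 0.

Definition g2_orth phi (X : V) : {vspace V} :=
  lker (linfun (g2_metric phi X : V -> R^o)).

End G2.

(* An SU(3)-structure is given by omega and the imaginary part psi of the
   complex volume form. *)
Definition su3_structure (R : realType) (W : vectType R)
    (omega : 2.-tuple W -> R) (psi : 3.-tuple W -> R) : Prop :=
  [/\ is_form omega, is_form psi &
      exists f : 6.-tuple 'Hom(W, R^o),
        [/\ is_coframe f,
            omega = ewedge f [tuple 1; 2]%N + ewedge f [tuple 3; 4]%N
                  + ewedge f [tuple 5; 6]%N &
            psi = - ewedge f [tuple 2; 4; 6]%N + ewedge f [tuple 1; 3; 6]%N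
                  + ewedge f [tuple 1; 4; 5]%N + ewedge f [tuple 2; 3; 5]%N]].

Section Reduction.
Variables (R : realType) (V W : vectType R).
Variables (phi : 3.-tuple V -> R) (pi : 'Hom(V, W)) (X : V).

Definition g2_unit_kernel : Prop :=
  g2_metric phi X X = 1 /\ (<[X]> = lker pi)%VS.

(* The restriction of pi to the orthogonal complement of X, and its lfun
   inverse, which is two-sided as soon as pi is onto and X is a unit vector
   spanning its kernel. *)
Definition orth_proj : 'Hom(subvs_of (g2_orth phi X), W) :=
  (pi \o linfun vsval)%VF.

Definition orth_lift : 'Hom(W, subvs_of (g2_orth phi X)) := (orth_proj^-1)%VF.

Definition su3_omega : 2.-tuple W -> R :=
  pullback orth_lift (pullback vsval (contract X phi)).

Definition su3_psi : 3.-tuple W -> R :=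
  pullback orth_lift (pullback vsval (- contract X (g2_star phi))).

End Reduction.

(* Main.v *)
(* In the coordinates of an adapted coframe, phi and *phi are the model forms on
   R^7.  The group of linear maps preserving the model metric, 3-form and 4-form
   is transitive on the unit sphere, so some adapted coframe satisfies
   e^7(X) = 1 and e^i(X) = 0 for i < 7; its first six members restrict to an
   SU(3)-coframe of the orthogonal complement of X.  For closedness,
   -iota_X *phi is the pullback of psi by pi, because it is annihilated by X and
   lifts of brackets agree with brackets of lifts modulo X; and
   d (iota_X *phi) = - iota_X d *phi = 0, because X is central. *)
Require Import Defs.
From HB Require Import structures.
From mathcomp Require Import all_boot all_order all_algebra.
From mathcomp Require Import all_classical all_reals.
From mathcomp Require Import ring lra zify.

Set Implicit Arguments.
Unset Strict Implicit.
Unset Printing Implicit Defensive.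

Import Order.TTheory GRing.Theory Num.Theory.
Local Open Scope ring_scope.

(** * The model on R^7 *)

Section Model.
Variable R : realType.
Implicit Types x y z w : nat -> R.

(* Points of R^7 are represented by x : nat -> R with coordinates x 1, .., x 7. *)
Definition wedge2 (i j : nat) x y := x i * y j - x j * y i.

Definition wedge3 (i j k : nat) x y z :=
  x i * wedge2 j k y z - y i * wedge2 j k x z + z i * wedge2 j k x y.

Definition wedge4 (i j k l : nat) x y z w :=
  x i * wedge3 j k l y z w - y i * wedge3 j k l x z w
  + z i * wedge3 j k l x y w - w i * wedge3 j k l x y z.

Definition dot7 x y :=
  x 1%N * y 1%N + x 2%N * y 2%N + x 3%N * y 3%N + x 4%N * y 4%N
  + x 5%N * y 5%N + x 6%N * y 6%N + x 7%N * y 7%N.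

Definition model3 x y z :=
  wedge3 1 2 7 x y z + wedge3 3 4 7 x y z + wedge3 5 6 7 x y z
  + wedge3 1 3 5 x y z - wedge3 1 4 6 x y z - wedge3 2 3 6 x y z
  - wedge3 2 4 5 x y z.

Definition model4 x y z w :=
  wedge4 1 2 3 4 x y z w + wedge4 1 2 5 6 x y z w + wedge4 1 3 6 7 x y z w
  + wedge4 1 4 5 7 x y z w + wedge4 2 3 5 7 x y z w - wedge4 2 4 6 7 x y z w
  + wedge4 3 4 5 6 x y z w.

(* The hyperkaehler triple on the span of e_1, .., e_4.  The model forms depend on
   these coordinates only through it, as e^{1234} = hyper1 /\ hyper1 / 2. *)
Definition hyper1 x y := wedge2 1 2 x y + wedge2 3 4 x y.
Definition hyper2 x y := wedge2 1 3 x y - wedge2 2 4 x y.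
Definition hyper3 x y := wedge2 1 4 x y + wedge2 2 3 x y.

Lemma model3E x y z : model3 x y z =
  wedge3 5 6 7 x y z
  + (x 7%N * hyper1 y z - y 7%N * hyper1 x z + z 7%N * hyper1 x y)
  + (x 5%N * hyper2 y z - y 5%N * hyper2 x z + z 5%N * hyper2 x y)
  - (x 6%N * hyper3 y z - y 6%N * hyper3 x z + z 6%N * hyper3 x y).
Proof.
rewrite /model3 /hyper1 /hyper2 /hyper3 /wedge3 /wedge2.
ring.
Qed.

(** The wedge product of two 2-forms, as a signed sum over (2,2)-shuffles. *)
Definition shuffle22 (a b : (nat -> R) -> (nat -> R) -> R) x y z w :=
  a x y * b z w - a x z * b y w + a x w * b y z
  + a y z * b x w - a y w * b x z + a z w * b x y.

Lemma model4E x y z w : model4 x y z w =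
  hyper1 x y * hyper1 z w - hyper1 x z * hyper1 y w + hyper1 x w * hyper1 y z
  + shuffle22 hyper1 (wedge2 5 6) x y z w
  + shuffle22 hyper2 (wedge2 6 7) x y z w
  + shuffle22 hyper3 (wedge2 5 7) x y z w.
Proof.
rewrite /model4 /shuffle22 /hyper1 /hyper2 /hyper3 /wedge4 /wedge3 /wedge2.
ring.
Qed.

Record g2_symmetry (T : (nat -> R) -> (nat -> R)) : Prop := G2Symmetry {
  g2sym_linear : forall a x y, T (a \*o x \+ y) =1 a \*o T x \+ T y;
  g2sym_dot : forall x y, dot7 (T x) (T y) = dot7 x y;
  g2sym_model3 : forall x y z, model3 (T x) (T y) (T z) = model3 x y z;
  g2sym_model4 : forall x y z w,
    model4 (T x) (T y) (T z) (T w) = model4 x y z w }.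

Lemma g2_symmetry_comp T U :
  g2_symmetry T -> g2_symmetry U -> g2_symmetry (T \o U).
Proof.
case=> lT dT pT qT [lU dU pU qU]; split=> [a x y i|x y|x y z|x y z w] /=.
- by rewrite (_ : U _ = a \*o U x \+ U y) ?lT //; apply/funext => j; apply: lU.
- by rewrite dT dU.
- by rewrite pT pU.
- by rewrite qT qU.
Qed.

(* An automorphism of the Fano plane for which all signs are positive. *)
Definition fano_cycle x : nat -> R :=
  nth 0 [:: 0; x 4%N; x 1%N; x 7%N; x 5%N; x 3%N; x 2%N; x 6%N].

Lemma g2_symmetry_fano_cycle : g2_symmetry fano_cycle.
Proof.
split=> [a x y|x y|x y z|x y z w].
(* Indices 0 to 7 are treated one by one; past the end of the list [nth] gives its default 0, which
   is linear too. *)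
- by move=> i; do 8?[case: i => [|i]];
  rewrite /fano_cycle /= ?nth_nil ?mulr0 ?addr0.
- rewrite /dot7 /fano_cycle /=; ring.
- rewrite /model3 /fano_cycle /wedge3 /wedge2 /=; ring.
- rewrite /model4 /fano_cycle /wedge4 /wedge3 /wedge2 /=.
  move: (x 1%N) (x 2%N) (x 3%N) (x 4%N) (x 5%N) (x 6%N) (x 7%N)
    (y 1%N) (y 2%N) (y 3%N) (y 4%N) (y 5%N) (y 6%N) (y 7%N)
    (z 1%N) (z 2%N) (z 3%N) (z 4%N) (z 5%N) (z 6%N) (z 7%N)
    (w 1%N) (w 2%N) (w 3%N) (w 4%N) (w 5%N) (w 6%N) (w 7%N) => *.
  ring.
Qed.

(* Writing hyper_a(x, y) = <I_a x, y> with quaternionic units I_a, this sends the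
   orthonormal basis u, I_1 u, I_2 u, I_3 u to e_1, .., e_4, hence commutes with
   the I_a. *)
Definition rotation4 (u x : nat -> R) : nat -> R :=
  nth 0 [:: 0; u 1%N * x 1%N + u 2%N * x 2%N + u 3%N * x 3%N + u 4%N * x 4%N;
            hyper1 u x; hyper2 u x; hyper3 u x; x 5%N; x 6%N; x 7%N].

Lemma g2_symmetry_rotation4 (u : nat -> R) :
  u 1%N ^+ 2 + u 2%N ^+ 2 + u 3%N ^+ 2 + u 4%N ^+ 2 = 1 ->
  g2_symmetry (rotation4 u).
Proof.
move=> u1.
have H1 x y : hyper1 (rotation4 u x) (rotation4 u y) = hyper1 x y.
  (* As a polynomial, the rotated form is |u|^2 times the original; rewriting 1 as |u|^2 on the
     right leaves a ring identity. *)
  rewrite -[RHS]mul1r -u1 /hyper1 /rotation4 /hyper1 /hyper2 /hyper3 /wedge2 /=;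
  ring.
have H2 x y : hyper2 (rotation4 u x) (rotation4 u y) = hyper2 x y.
  rewrite -[RHS]mul1r -u1 /hyper2 /rotation4 /hyper1 /hyper2 /hyper3 /wedge2 /=;
  ring.
have H3 x y : hyper3 (rotation4 u x) (rotation4 u y) = hyper3 x y.
  rewrite -[RHS]mul1r -u1 /hyper3 /rotation4 /hyper1 /hyper2 /hyper3 /wedge2 /=;
  ring.
split=> [a x y|x y|x y z|x y z w].
- move=> i; do 8?[case: i => [|i]]; rewrite /rotation4 /= ?nth_nil /hyper1 /hyper2 /hyper3 /wedge2 /=;
  ring.
(* Only the first four coordinates are rotated, so the factor |u|^2 = 1 goes on their part alone. *)
- have -> : dot7 x y = (x 1%N * y 1%N + x 2%N * y 2%N + x 3%N * y 3%N
      + x 4%N * y 4%N) * 1 + x 5%N * y 5%N + x 6%N * y 6%N + x 7%N * y 7%N.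
    by rewrite mulr1.
  rewrite -u1 /dot7 /rotation4 /hyper1 /hyper2 /hyper3 /wedge2 /=;
  ring.
- by rewrite !model3E !H1 !H2 !H3.
- by rewrite !model4E /shuffle22 !H1 !H2 !H3.
Qed.

(** Take u to be the normalised first four coordinates of x: the new first coordinate is their norm,
    and the next three vanish because the [hyper] forms are alternating. If these four are zero, u =
    e_1 serves. *)
Lemma g2_symmetry_clear4 x : exists T,
  [/\ g2_symmetry T, 0 <= T x 1%N &
      [/\ T x 2%N = 0, T x 3%N = 0, T x 4%N = 0 &
          [/\ T x 5%N = x 5%N, T x 6%N = x 6%N & T x 7%N = x 7%N]]].
Proof.
set N := x 1%N ^+ 2 + x 2%N ^+ 2 + x 3%N ^+ 2 + x 4%N ^+ 2.
have N_ge0 : 0 <= N by rewrite !addr_ge0 ?sqr_ge0.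
have [N0|N_neq0] := eqVneq N 0.
  have [x1 x2 x3 x4] : [/\ x 1%N = 0, x 2%N = 0, x 3%N = 0 & x 4%N = 0].
    by move: N0; rewrite /N; split; nra.
  exists (rotation4 (fun n => (n == 1%N)%:R)); split.
  - by apply: g2_symmetry_rotation4; rewrite /= expr1n expr0n /=; ring.
  - by rewrite /rotation4 /= x1 x2 x3 x4 !mulr0 !addr0.
  - rewrite /rotation4 /hyper1 /hyper2 /hyper3 /wedge2 /= x1 x2 x3 x4.
    by split=> //; ring.
have r_gt0 : 0 < Num.sqrt N by rewrite sqrtr_gt0 lt_neqAle eq_sym N_neq0.
have r_neq0 : Num.sqrt N != 0 by rewrite gt_eqF.
exists (rotation4 (fun n => x n / Num.sqrt N)); split.
- apply: g2_symmetry_rotation4; rewrite !expr_div_n !sqr_sqrtr //.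
  by rewrite -!mulrDl divff.
- rewrite /rotation4 /= (_ : _ + _ = N / Num.sqrt N) ?divr_ge0 ?sqrtr_ge0 //.
  by rewrite /N; field.
- by rewrite /rotation4 /hyper1 /hyper2 /hyper3 /wedge2 /=; split=> //; field.
Qed.

(* Coordinates 2, 3, 4 are cleared; the cycle then moves 1, 6, 7 to 2, 7, 3, and
   5 to 4, leaving only coordinates 1 and 7 after a second clearing, which
   the cycle moves to 2 and 3; its cube finally moves 1 to 7. *)
Lemma g2_symmetry_transitive x : dot7 x x = 1 -> exists T,
  g2_symmetry T /\ [/\ T x 1%N = 0, T x 2%N = 0, T x 3%N = 0 &
    [/\ T x 4%N = 0, T x 5%N = 0, T x 6%N = 0 & T x 7%N = 1]].
Proof.
move=> x1.
have [T [gT _ [T2 T3 T4 [T5 T6 T7]]]] := g2_symmetry_clear4 x.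
have [U [gU _ [U2 U3 U4 [U5 U6 U7]]]] := g2_symmetry_clear4 (fano_cycle (T x)).
have [V [gV V1 [V2 V3 V4 [V5 V6 V7]]]] :=
  g2_symmetry_clear4 (fano_cycle (U (fano_cycle (T x)))).
have gP := g2_symmetry_fano_cycle.
set S := V \o (fano_cycle \o (U \o (fano_cycle \o T))).
have gS : g2_symmetry S.
  by do 4!apply: (g2_symmetry_comp _ _) => //.
exists (fano_cycle \o (fano_cycle \o (fano_cycle \o S))); split.
  by do 3!apply: (g2_symmetry_comp gP).
have [S2 S3 S4] : [/\ S x 2%N = 0, S x 3%N = 0 & S x 4%N = 0] by [].
have S5 : S x 5%N = 0 := etrans V5 U3.
have S6 : S x 6%N = 0 := etrans V6 U2.
have S7 : S x 7%N = 0 := etrans V7 (etrans U6 T2).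
have S1 : S x 1%N = 1.
  (* Norm preservation leaves 1 or -1; the sign clause of the last clearing excludes -1. *)
  have := g2sym_dot gS x x; rewrite x1 /dot7 S2 S3 S4 S5 S6 S7 !mulr0 !addr0.
  move/eqP; rewrite -expr2 sqrf_eq1 => /orP[/eqP //|/eqP S1].
  by have := V1; rewrite -[V _ _]/(S x 1%N) S1 ler0N1.
by split; last split.
Qed.

End Model.

(** * Coframes, wedge products and the Hodge star *)

Section Coframes.
Variables (R : realType) (V : vectType R) (n : nat).
Implicit Type e : n.-tuple 'Hom(V, R^o).

Lemma linfunE (W : vectType R) (f : V -> W) : linear f -> linfun f =1 f.
Proof.
move=> lf.
pose fL : {linear V -> W} := HB.pack f (GRing.isLinear.Build R V W *:%R f lf).
exact: (lfunE fL).
Qed.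

(** A coframe spans the dual space, so every functional kills v, in particular the coordinates in a
    basis of V. *)
Lemma coframe_eq0 e v :
  is_coframe e -> (forall i, tnth e i v = 0) -> v = 0.
Proof.
move=> /andP[/eqP e_span _] ev0.
have all0 (f : 'Hom(V, R^o)) : f v = 0.
  have : f \in <<e>>%VS by rewrite e_span memvf.
  move=> /coord_span ->; rewrite sum_lfunE big1 // => i _.
  by rewrite lfunE /= -tnth_nth ev0 scaler0.
rewrite (coord_vbasis (memvf v)) big1 // => i _.
rewrite -[coord _ _ v](lfunE (coord (vbasis fullv) i : {linear V -> R^o})).
by rewrite all0 scale0r.
Qed.

(** The evaluation map is injective by hypothesis, hence onto by dimension, so its [lfun] inverse is
    a right inverse. *)
Lemma dual_frameE e : \dim {:V} = n ->
  (forall v, (forall i, tnth e i v = 0) -> v = 0) ->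
  forall i j, tnth e i (dual_frame e j) = (i == j)%:R.
Proof.
move=> dimV e_inj i j; rewrite /dual_frame.
set f := (fun x : V => _).
have lf : linear f.
  by move=> a x y; apply/rowP => k; rewrite !mxE linearP.
have injF : lker (linfun f) == 0%VS.
  rewrite -subv0; apply/subvP => v.
  rewrite memv_ker linfunE // memv0 => /eqP/rowP f0.
  by apply/eqP/e_inj => k; have := f0 k; rewrite !mxE.
have surjF : limg (linfun f) = fullv.
  apply/eqP; rewrite eqEdim subvf /= limg_dim_eq ?dimV ?(eqP injF) ?capv0 //.
  by rewrite dimvf /dim /= mul1n.
have := limg_lfunVK (f := linfun f) (x := delta_mx 0 j).
rewrite surjF memvf linfunE // => /(_ isT) /rowP/(_ i).
by rewrite !mxE eqxx.
Qed.

(** Evaluating a vanishing combination at the dual frame isolates each coefficient; freeness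
    suffices since the dual has dimension n. *)
Lemma coframe_of_inj e : \dim {:V} = n ->
  (forall v, (forall i, tnth e i v = 0) -> v = 0) -> is_coframe e.
Proof.
move=> dimV e_inj; rewrite /is_coframe basisEfree subvf size_tuple.
apply/and3P; split=> //; last first.
  by rewrite dimvf /dim /= muln1 -dimV dimvf.
apply/freeP => k sum0 j.
have := congr1 (fun f : 'Hom(V, R^o) => f (dual_frame e j)) sum0.
rewrite /= sum_lfunE lfunE /= (bigD1 j) //= big1 ?addr0 => [|i ij].
  rewrite lfunE /= -tnth_nth dual_frameE // eqxx => /eqP.
  by rewrite scaler_eq0 oner_eq0 orbF => /eqP.
by rewrite lfunE /= -tnth_nth dual_frameE // (negbTE ij) scaler0.
Qed.

End Coframes.

(** * Wedge products as alternating forms and as polynomials in coordinates *)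

Section Wedge.
Variables (R : realType) (V : vectType R).
Implicit Type e : seq 'Hom(V, R^o).

Lemma is_formD k (a b : k.-tuple V -> R) :
  is_form a -> is_form b -> is_form (a + b).
Proof.
move=> [la za] [lb zb]; split=> [v i c x y|v i j ij vij].
  rewrite !fctE; have /= -> := la v i c x y; have /= -> := lb v i c x y.
  rewrite /GRing.scale /=; ring.
by rewrite !fctE (za v i j) // (zb v i j) // addr0.
Qed.

Lemma is_formN k (a : k.-tuple V -> R) : is_form a -> is_form (- a).
Proof.
move=> [la za]; split=> [v i c x y|v i j ij vij].
  rewrite !fctE; have /= -> := la v i c x y.
  rewrite /GRing.scale /=; ring.
by rewrite !fctE (za v i j) // oppr0.
Qed.

Lemma is_form_ewedge e k (I : k.-tuple nat) : is_form (ewedge e I).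
Proof.
(* Transposing makes each argument of the form a row, so that the row lemmas on determinants
   apply. *)
have ewedge_tr v : ewedge e I v =
    \det (\matrix_(j < k, i < k) (e`_(tnth I i).-1 (tnth v j) : R)).
  by rewrite -det_tr; congr (\det _); apply/matrixP => i j; rewrite !mxE.
split=> [v i c x y|v i j ij vij]; rewrite !ewedge_tr; last first.
  by apply: (determinant_alternate ij) => l; rewrite !mxE vij.
rewrite -[X in _ = _ + X]mul1r; apply: (determinant_multilinear (i0 := i)).
- by apply/rowP => j; rewrite !mxE !tnth_mktuple eqxx linearP mul1r.
- by apply/matrixP => j l; rewrite !mxE !tnth_mktuple eq_sym
    (negbTE (neq_lift _ _)).
- by apply/matrixP => j l; rewrite !mxE !tnth_mktuple eq_sym
    (negbTE (neq_lift _ _)).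
Qed.

Lemma det_expand_col0 n (F : nat -> nat -> R) :
  \det (\matrix_(i < n.+1, j < n.+1) F i j) =
  \sum_(m < n.+1) (-1) ^+ m * F m 0%N
                  * \det (\matrix_(i < n, j < n) F (bump m i) j.+1).
Proof.
rewrite (expand_det_col _ ord0); apply: eq_bigr => m _.
rewrite !mxE /cofactor addn0 mulrCA mulrA; congr (_ * \det _).
by apply/matrixP => i j; rewrite !mxE.
Qed.

(* A form of the determinant that simplification unrolls. *)
Fixpoint laplace n (F : nat -> nat -> R) : R :=
  if n is p.+1 then
    \sum_(m <- iota 0 p.+1)
      (-1) ^+ m * F m 0%N * laplace p (fun i j => F (bump m i) j.+1)
  else 1.

Lemma det_laplace n (F : nat -> nat -> R) :
  \det (\matrix_(i < n, j < n) F i j) = laplace n F.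
Proof.
elim: n F => [|n IHn] F; first by rewrite det_mx00.
rewrite det_expand_col0 -[RHS]/(\sum_(0 <= m < n.+1) _) big_mkord.
by apply: eq_bigr => m _; rewrite (IHn (fun i j => F (bump m i) j.+1)).
Qed.
(** Meant for columns that hold the coordinates of a dual frame vector. *)
Lemma det_delta_col0 n (F : nat -> nat -> R) m : (m < n.+1)%N ->
  (forall i, (i < n.+1)%N -> F i 0%N = (i == m)%:R) ->
  \det (\matrix_(i < n.+1, j < n.+1) F i j) =
  (-1) ^+ m * \det (\matrix_(i < n, j < n) F (bump m i) j.+1).
Proof.
move=> mn Fm; rewrite det_expand_col0 (bigD1 (Ordinal mn)) //= big1 ?addr0.
  by rewrite Fm // eqxx mulr1.
by move=> i im; rewrite Fm // -val_eqE /= in im *; rewrite (negbTE im) mulr0 mul0r.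
Qed.

(* 1-based, as the indices of [ewedge]; [coords e v 0] is junk. *)
Definition coords e v n : R := e`_n.-1 v.

Lemma ewedgeE e k (I : k.-tuple nat) (v : k.-tuple V) :
  ewedge e I v = \det (\matrix_(i < k, j < k) coords e (v`_j) (nth 0%N I i)).
Proof.
congr (\det _); apply/matrixP => i j.
by rewrite !mxE (tnth_nth 0%N I) (tnth_nth 0 v) /coords.
Qed.


Lemma ewedge2E e i j (v : 2.-tuple V) :
  ewedge e [tuple i; j] v = wedge2 i j (coords e v`_0) (coords e v`_1).
Proof.
rewrite ewedgeE (det_laplace _
  (fun a b => coords e (v`_b) (nth 0%N [:: i; j] a))).
by rewrite /wedge2 /= !big_cons !big_nil /=; ring.
Qed.

Lemma ewedge3E e i j k (v : 3.-tuple V) : ewedge e [tuple i; j; k] v =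
  wedge3 i j k (coords e v`_0) (coords e v`_1) (coords e v`_2).
Proof.
rewrite ewedgeE (det_laplace _
  (fun a b => coords e (v`_b) (nth 0%N [:: i; j; k] a))).
by rewrite /wedge3 /wedge2 /= !big_cons !big_nil /=; ring.
Qed.

Lemma ewedge4E e i j k l (v : 4.-tuple V) : ewedge e [tuple i; j; k; l] v =
  wedge4 i j k l (coords e v`_0) (coords e v`_1) (coords e v`_2) (coords e v`_3).
Proof.
rewrite ewedgeE (det_laplace _
  (fun a b => coords e (v`_b) (nth 0%N [:: i; j; k; l] a))).
by rewrite /wedge4 /wedge3 /wedge2 /= !big_cons !big_nil /=; ring.
Qed.

End Wedge.

(** * The Hodge star of a wedge monomial *)

Section Hodge.
Variables (R : realType) (V : vectType R).

Lemma hodgeD k m (e : (k + m).-tuple 'Hom(V, R^o)) (a b : k.-tuple V -> R) :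
  hodge e (a + b) = hodge e a + hodge e b.
Proof.
apply/funext => v; rewrite !fctE /hodge -big_split.
by apply: eq_bigr => s _ /=; rewrite -mulrDl.
Qed.

Lemma hodgeN k m (e : (k + m).-tuple 'Hom(V, R^o)) (a : k.-tuple V -> R) :
  hodge e (- a) = - hodge e a.
Proof.
apply/funext => v; rewrite !fctE /hodge -sumrN.
by apply: eq_bigr => s _ /=; rewrite -mulNr.
Qed.

(** An increasing map is determined by its image: the value lists are sorted without repetition and
    of equal length, so inclusion of one in the other forces equality. *)
Lemma increasing_inj k n (s t : {ffun 'I_k -> 'I_n}) :
  increasing s -> increasing t -> (forall i, exists j, t i = s j) -> s = t.
Proof.
move=> inc_s inc_t ts.
have lt_s (r : {ffun 'I_k -> 'I_n}) : increasing r ->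
    sorted ltn [seq val (r i) | i <- enum 'I_k].
  move=> /forallP inc_r; rewrite sorted_map.
  have : sorted ltn (map val (enum 'I_k)) by rewrite val_enum_ord iota_ltn_sorted.
  rewrite sorted_map; apply: sub_sorted => i j /= ij.
  by have /forallP/(_ j)/implyP := inc_r i; apply.
have E : [seq val (t i) | i <- enum 'I_k] = [seq val (s i) | i <- enum 'I_k].
  have ut : uniq [seq val (t i) | i <- enum 'I_k].
    exact: (sorted_uniq ltn_trans ltnn (lt_s _ inc_t)).
  apply: (irr_sorted_eq ltn_trans ltnn) (lt_s _ inc_t) (lt_s _ inc_s) _.
  apply: (snd (uniq_min_size ut _ _)); last by rewrite !size_map.
  move=> _ /mapP[i _ ->]; have [j ->] := ts i.
  by apply: map_f; rewrite mem_enum.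
apply/ffunP => i; apply/val_inj.
by have /eq_in_map := esym E; apply; rewrite mem_enum.
Qed.

(** In the sum defining the star, the coefficient of t is a determinant of Kronecker deltas: 1 for t
    = s, and otherwise 0 because some row vanishes. *)
Lemma hodge_ewedge k m (e : (k + m).-tuple 'Hom(V, R^o)) s v :
  (forall i j, tnth e i (dual_frame e j) = (i == j)%:R) -> increasing s ->
  hodge e (ewedge e [tuple (s i).+1 | i < k]) v =
  volume e [tuple of [tuple dual_frame e (s i) | i < k] ++ v].
Proof.
move=> eE inc_s.
have eEs (t : {ffun 'I_k -> 'I_(k + m)}) :
    ewedge e [tuple (s i).+1 | i < k] [tuple dual_frame e (t i) | i < k] =
    \det (\matrix_(i < k, j < k) (s i == t j)%:R).
  congr (\det _); apply/matrixP => i j.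
  by rewrite !mxE !tnth_mktuple /= -tnth_nth eE.
rewrite /hodge (bigD1 s) //= big1 ?addr0 => [|t /andP[inc_t ts]]; rewrite eEs.
  rewrite (_ : \matrix_(_, _) _ = 1%:M) ?det1 ?mul1r //.
  apply/matrixP => i j; rewrite !mxE; congr (_%:R); congr nat_of_bool.
  have [->|ij] := eqVneq i j; first exact: eqxx.
  have inc := forallP inc_s.
  rewrite -val_eqE neq_ltn in ij; apply/negbTE; rewrite -val_eqE neq_ltn.
  case/orP: ij => ij.
    by have /forallP/(_ j)/implyP -> := inc i.
  by have /forallP/(_ i)/implyP -> := inc j; rewrite ?orbT.
(* If t attained every value of s, the two would coincide. *)
have [i0 i0P] : exists i, forall j, s i != t j.
  apply/not_existsP => st; case/eqP: ts; apply: increasing_inj => // i.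
  have := st i => /existsNP[j] /negP; rewrite negbK => /eqP ij.
  by exists j.
rewrite (expand_det_row _ i0) big1 ?mul0r // => j _.
by rewrite mxE (negbTE (i0P j)) mul0r.
Qed.

End Hodge.

(** * Contraction with a central vector *)

Section AlternatingForms.
Variables (R : realType) (V : vectType R).

Lemma form_linear0 k (a : k.+1.-tuple V -> R) c x y (t : k.-tuple V) :
  is_form a ->
  a [tuple of c *: x + y :: t] = c * a [tuple of x :: t] + a [tuple of y :: t].
Proof.
case=> la _; have := la [tuple of x :: t] ord0 c x y.
have E z : [tuple if j == ord0 then z else tnth [tuple of x :: t] j | j < k.+1]
           = [tuple of z :: t].
  apply: eq_from_tnth => j; rewrite tnth_mktuple.
  by case: (unliftP ord0 j) => [i ->|->] //=; rewrite !tnthS.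
by rewrite !E.
Qed.

Lemma form_linear1 k (a : k.+2.-tuple V -> R) c x y z (t : k.-tuple V) :
  is_form a ->
  a [tuple of z :: c *: x + y :: t] =
  c * a [tuple of z :: x :: t] + a [tuple of z :: y :: t].
Proof.
case=> la _; have := la [tuple of z :: x :: t] (lift ord0 ord0) c x y.
have E u : [tuple if j == lift ord0 ord0 then u
                  else tnth [tuple of z :: x :: t] j | j < k.+2]
           = [tuple of z :: u :: t].
  apply: eq_from_tnth => j; rewrite tnth_mktuple.
  case: (unliftP ord0 j) => [i ->|->] //=; rewrite !tnthS.
  by case: (unliftP ord0 i) => [l ->|->] //=; rewrite !tnthS.
by rewrite !E.
Qed.

Lemma form_alternate01 k (a : k.+2.-tuple V -> R) x (t : k.-tuple V) :
  is_form a -> a [tuple of x :: x :: t] = 0.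
Proof. by case=> _ za; apply: (za _ ord0 (lift ord0 ord0)). Qed.

Lemma form_swap01 k (a : k.+2.-tuple V -> R) x y (t : k.-tuple V) :
  is_form a -> a [tuple of x :: y :: t] = - a [tuple of y :: x :: t].
Proof.
(* Polarisation: expand the vanishing value at (x + y, x + y); the factor 1 gives the sum the shape
   required by the linearity lemmas. *)
move=> fa; have := form_alternate01 (1 *: x + y) t fa.
rewrite form_linear1 // !(form_linear0 (a := a) _ _ _ [tuple of _ :: t]) //.
rewrite !form_alternate01 // !mul1r add0r addr0 => E; lra.
Qed.

Lemma form0l k (a : k.+1.-tuple V -> R) (t : k.-tuple V) :
  is_form a -> a [tuple of 0 :: t] = 0.
Proof.
move=> fa; have := form_linear0 (-1) 0 0 t fa.
by rewrite scaler0 addr0 mulN1r addNr.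
Qed.

(* Cartan's formula L_X = d iota_X + iota_X d, with L_X = 0 for a central X. *)
Lemma ce_diff_contract k (br : V -> V -> V) (a : k.+2.-tuple V -> R) X v :
  is_form a -> lie_central br X ->
  ce_diff br (Defs.contract X a) v = - ce_diff br a [tuple of X :: v].
Proof.
(* On X :: v the summand j = 0 is empty, as no i is smaller. *)
move=> fa cX; rewrite {2}/ce_diff big_ord_recl big1 ?add0r //.
have liftS n (p : 'I_n.+1) q :
    lift (lift ord0 p) (lift ord0 q) = lift ord0 (lift p q).
  by apply: val_inj; rewrite /= /bump !add1n ltnS addnS.
have lift0 n (p : 'I_n.+1) : lift (lift ord0 p) ord0 = ord0.
  exact: val_inj.
rewrite -sumrN; apply: eq_bigr => j _.
(* The term i = 0 contains a bracket with X and vanishes. In the others both indices shift by one,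
   which keeps the sign; the minus comes from exchanging X with the bracket. *)
rewrite [in RHS]big_mkcond big_ord_recl /= lift0 tnth0 cX form0l // mulr0 add0r.
rewrite big_mkcond -sumrN; apply: eq_bigr => i _.
rewrite ltnS; case: ifP => // _; last by rewrite oppr0.
rewrite addSn addnS !exprS !mulN1r opprK liftS !tnthS -mulrN; congr (_ * _).
transitivity (a [tuple of X :: br (tnth v (lift j i)) (tnth v j)
                   :: [tuple tnth v (lift j (lift i m)) | m < k]]).
  by congr (a _); apply: val_inj.
rewrite form_swap01 //; congr (- a _); apply: eq_from_tnth => m.
case: (unliftP ord0 m) => [{}m ->|->] //; rewrite !tnthS !tnth_mktuple.
case: (unliftP ord0 m) => [{}m ->|->]; last by rewrite !lift0.
by rewrite !liftS !tnthS tnth_mktuple.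
Qed.

Lemma ce_diffN k (br : V -> V -> V) (a : k.+1.-tuple V -> R) :
  ce_diff br (- a) = - ce_diff br a.
Proof.
apply/funext => v; rewrite -[RHS]/(- ce_diff br a v) /ce_diff -sumrN.
apply: eq_bigr => j _.
by rewrite /= -sumrN; apply: eq_bigr => i _; rewrite -mulrN.
Qed.

(** Compatibility with brackets is asked only inside [a], since the orthogonal lift respects
    brackets only modulo X. *)
Lemma ce_diff_pullback (W : vectType R) (brV : V -> V -> V) (brW : W -> W -> W)
    k (a : k.+1.-tuple V -> R) (f : W -> V) v :
  (forall x y (t : k.-tuple V), a [tuple of f (brW x y) :: t] =
    a [tuple of brV (f x) (f y) :: t]) ->
  ce_diff brW (pullback f a) v = ce_diff brV a (map_tuple f v).
Proof.
move=> fa; apply: eq_bigr => j _; apply: eq_bigr => i _; congr (_ * _).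
rewrite !tnth_map -fa /pullback; congr (a _); apply: eq_from_tnth => m.
rewrite tnth_map; case: (unliftP ord0 m) => [{}m ->|->] //.
by rewrite !tnthS !tnth_mktuple tnth_map.
Qed.

End AlternatingForms.

(** * G2-structures and their SU(3) reductions *)

Section G2Model.
Variables (R : realType) (V : vectType R).
Implicit Types (phi : 3.-tuple V -> R) (e : 7.-tuple 'Hom(V, R^o)).

(* The increasing multi-index is (m0, m1 + 1, m2 + 2) in 0-based form; composing
   the three bumps enumerates its complement. *)
Lemma hodge_ewedge3 e m0 m1 m2 v :
  (forall i j, tnth e i (dual_frame e j) = (i == j)%:R) ->
  (m0 <= m1)%N -> (m1 <= m2)%N -> (m2 < 5)%N ->
  @hodge R V 3 4 e (ewedge e [tuple m0.+1; m1.+2; m2.+3]) v =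
  (-1) ^+ (m0 + m1 + m2) *
  ewedge e [tuple (bump m0 (bump m1 (bump m2 0))).+1;
                  (bump m0 (bump m1 (bump m2 1))).+1;
                  (bump m0 (bump m1 (bump m2 2))).+1;
                  (bump m0 (bump m1 (bump m2 3))).+1] v.
Proof.
move=> eE m01 m12 m25.
pose I := [tuple m0; m1.+1; m2.+2].
have ltI (i : 'I_3) : (tnth I i < 7)%N.
  by case: i => [[|[|[|]]]] //= ?; rewrite /tnth /=; lia.
pose s : {ffun 'I_3 -> 'I_(3 + 4)} := [ffun i => Ordinal (ltI i)].
have inc_s : increasing s.
  apply/forallP => -[i i3]; apply/forallP => -[j j3]; apply/implyP.
  rewrite !ffunE /= !(tnth_nth 0%N) /=.
  by case: i i3 => [|[|[|]]] //; case: j j3 => [|[|[|]]] //= *; lia.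
have -> : [tuple m0.+1; m1.+2; m2.+3] = [tuple (s i).+1 | i < 3].
  apply: eq_from_tnth => i; rewrite tnth_mktuple ffunE /= !(tnth_nth 0%N) /=.
  by case: i => [[|[|[|]]]].
rewrite hodge_ewedge // /volume ewedgeE.
set Es := [tuple _ | i < 3]; set w := [tuple of Es ++ v].
(* The first three columns of the volume determinant are standard basis columns; the other four come
   from v. *)
have w_low (j : 'I_3) i : (i < 7)%N ->
    coords e (w`_j) i.+1 = (i == nth 0%N I j)%:R.
  move=> i7; rewrite -[w`_j]/((Es ++ v)`_j) nth_cat size_tuple ltn_ord.
  rewrite -(tnth_nth 0 Es) tnth_mktuple.
  rewrite /coords /= -(tnth_nth 0 e (Ordinal i7)) eE -val_eqE ffunE /=.
  by rewrite (tnth_nth 0%N).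
have w_high j : w`_(3 + j) = v`_j.
  by rewrite -[LHS]/((Es ++ v)`_(3 + j)) nth_cat size_tuple ltnNge leq_addr /=
    addKn.
have -> : \det (\matrix_(i < 3 + 4, j < 3 + 4)
      coords e w`_j (nth 0%N [tuple i.+1 | i < 3 + 4] i)) =
    \det (\matrix_(i < 7, j < 7) coords e w`_j i.+1).
  congr (\det _); apply/matrixP => i j.
  by rewrite !mxE -(tnth_nth 0%N _ i) tnth_mktuple.
(* Three expansions remove these columns. Once the earlier rows are deleted, the pivots sit in rows
   m0, m1, m2, whence the sign. *)
rewrite (@det_delta_col0 _ 6 (fun i j => coords e w`_j i.+1) m0) //; last first.
- by move=> i i7; rewrite (w_low 0).
- lia.
rewrite (@det_delta_col0 _ 5 (fun i j => coords e w`_j.+1 (bump m0 i).+1) m1) //;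
  last first.
- move=> i i6; rewrite (w_low 1) ?/bump; last by lia.
  by congr (_%:R); congr nat_of_bool; rewrite /=; lia.
- lia.
rewrite (@det_delta_col0 _ 4 (fun i j => coords e w`_j.+2 (bump m0 (bump m1 i)).+1)
  m2) //; last first.
- move=> i i6; rewrite (w_low 2) ?/bump; last by lia.
  by congr (_%:R); congr nat_of_bool; rewrite /=; lia.
rewrite [X in _ = _ * X]ewedgeE !mulrA -!exprD; congr (_ * \det _).
apply/matrixP => i j; rewrite !mxE -(w_high j); congr (coords e _ _).
by case: i => [[|[|[|[|]]]]].
Qed.

Lemma hodge_adapted phi e : \dim {:V} = 7%N -> g2_adapted phi e ->
  @hodge R V 3 4 e phi =
    ewedge e [tuple 1; 2; 3; 4]%N + ewedge e [tuple 1; 2; 5; 6]%N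
  + ewedge e [tuple 1; 3; 6; 7]%N + ewedge e [tuple 1; 4; 5; 7]%N
  + ewedge e [tuple 2; 3; 5; 7]%N - ewedge e [tuple 2; 4; 6; 7]%N
  + ewedge e [tuple 3; 4; 5; 6]%N.
Proof.
move=> dimV [e_co ->]; apply/funext => v.
have eE := dual_frameE dimV (fun v => @coframe_eq0 _ _ _ e v e_co).
rewrite !(hodgeD, hodgeN) !fctE.
(* Each monomial e^{ijk} is encoded by (i - 1, j - 2, k - 3). *)
rewrite (hodge_ewedge3 (m0 := 0) (m1 := 0) (m2 := 4)) //.
rewrite (hodge_ewedge3 (m0 := 2) (m1 := 2) (m2 := 4)) //.
rewrite (hodge_ewedge3 (m0 := 4) (m1 := 4) (m2 := 4)) //.
rewrite (hodge_ewedge3 (m0 := 0) (m1 := 1) (m2 := 2)) //.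
rewrite (hodge_ewedge3 (m0 := 0) (m1 := 2) (m2 := 3)) //.
rewrite (hodge_ewedge3 (m0 := 1) (m1 := 1) (m2 := 3)) //.
rewrite (hodge_ewedge3 (m0 := 1) (m1 := 2) (m2 := 2)) //.
rewrite /bump /=.
ring.
Qed.

End G2Model.

(** * Metric, 3-form and 4-form in the chosen adapted coframe *)

Section G2Structure.
Variables (R : realType) (V : vectType R) (dimV : \dim {:V} = 7%N).
Variables (phi : 3.-tuple V -> R) (phi_g2 : g2_structure phi).

Let e := g2_coframe phi.

Lemma g2_coframeP : g2_adapted phi e.
Proof. by case: phi_g2 => _; apply: xgetPex. Qed.

Lemma g2_phiE v :
  phi v = model3 (coords e (v`_0)) (coords e (v`_1)) (coords e (v`_2)).
Proof.
by have [_ phiE] := g2_coframeP; rewrite {1}phiE !fctE !ewedge3E.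
Qed.

Lemma g2_starE v : g2_star phi v =
  model4 (coords e (v`_0)) (coords e (v`_1)) (coords e (v`_2)) (coords e (v`_3)).
Proof. by rewrite /g2_star (hodge_adapted dimV g2_coframeP) !fctE !ewedge4E. Qed.

Lemma is_form_g2_star : is_form (g2_star phi).
Proof.
rewrite /g2_star (hodge_adapted dimV g2_coframeP).
by do ![apply: is_formD|apply: is_formN|apply: is_form_ewedge].
Qed.

Lemma g2_metricE x y : g2_metric phi x y = dot7 (coords e x) (coords e y).
Proof.
by rewrite /g2_metric !big_ord_recl big_ord0 /dot7 /coords !(tnth_nth 0) /=; ring.
Qed.

Lemma g2_metric_linear x : linear (g2_metric phi x : V -> R^o).
Proof.
move=> a y z; rewrite /g2_metric scaler_sumr -big_split; apply: eq_bigr => i _.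
by rewrite linearP mulrDr /=; congr (_ + _); exact: mulrCA.
Qed.

Lemma g2_metricC x y : g2_metric phi x y = g2_metric phi y x.
Proof. by apply: eq_bigr => i _; rewrite mulrC. Qed.

Lemma g2_metric_ge0 x : 0 <= g2_metric phi x x.
Proof. by apply: sumr_ge0 => i _; rewrite -expr2 sqr_ge0. Qed.

Lemma g2_metric_eq0 x : g2_metric phi x x = 0 -> x = 0.
Proof.
move=> x0; have [e_co _] := g2_coframeP; apply: (coframe_eq0 e_co) => i.
have sq_ge0 (j : 'I_7) : true -> 0 <= (tnth e j x : R) * tnth e j x.
  by rewrite -expr2 sqr_ge0.
have /eqP : (tnth e i x : R) * tnth e i x = 0 := psumr_eq0P sq_ge0 x0 isT.
by rewrite mulf_eq0 orbb => /eqP.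
Qed.

Lemma coords_linear a x y : coords e (a *: x + y) = a \*o coords e x \+ coords e y.
Proof. by apply/funext => n; rewrite /coords linearP. Qed.

(** * The induced SU(3)-structure on the quotient *)

Section Quotient.
Variables (W : vectType R) (pi : 'Hom(V, W)) (X : V).
Hypotheses (pi_onto : limg pi = fullv) (X_unit : g2_unit_kernel phi pi X).

Let L (w : W) : V := vsval (orth_lift phi pi X w).

Lemma orth_lift_orth w : g2_metric phi X (L w) = 0.
Proof.
have := subvsP (orth_lift phi pi X w); rewrite memv_ker linfunE.
  by move/eqP.
exact: g2_metric_linear.
Qed.

(** The restricted projection is still onto: subtracting from a vector its component along X does
    not change its image. *)
Lemma pi_orth_lift w : pi (L w) = w.
Proof.
have [XX kerX] := X_unit.
have pX : pi X = 0 by apply/eqP; rewrite -memv_ker -kerX memv_line.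
have onto : limg (orth_proj phi pi X) = fullv.
  apply/vspaceP => u; rewrite memvf; have : u \in limg pi by rewrite pi_onto memvf.
  case/memv_imgP => x _ ->.
  have xX : x - g2_metric phi X x *: X \in g2_orth phi X.
    rewrite memv_ker linfunE; last exact: g2_metric_linear.
    by rewrite addrC -scaleNr g2_metric_linear XX /GRing.scale /= mulr1 addNr.
  apply/memv_imgP; exists (Subvs xX); first exact: memvf.
  by rewrite comp_lfunE lfunE /= linearB linearZ /= pX scaler0 subr0.
have := limg_lfunVK (f := orth_proj phi pi X) (x := w).
by rewrite onto memvf => /(_ isT); rewrite comp_lfunE lfunE.
Qed.

Lemma orth_lift_linear : linear L.
Proof. by move=> a x y; rewrite /L !linearP. Qed.

Lemma su3_psiE : su3_psi phi pi X = pullback L (- Defs.contract X (g2_star phi)).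
Proof.
apply/funext => w; rewrite /su3_psi /pullback; congr ((- _) _).
by apply: val_inj; rewrite /= -map_comp.
Qed.

Lemma su3_structure_quotient : \dim {:W} = 6%N ->
  su3_structure (su3_omega phi pi X) (su3_psi phi pi X).
Proof.
move=> dimW; have [XX kerX] := X_unit.
have [T [gT [T1 T2 T3 [T4 T5 T6 T7]]]] : exists T, g2_symmetry T /\ _ :=
  g2_symmetry_transitive (etrans (esym (g2_metricE X X)) XX).
pose f : 6.-tuple 'Hom(W, R^o) :=
  [tuple linfun (fun w => T (coords e (L w)) i.+1 : R^o) | i < 6].
have fE (i : 'I_6) w : tnth f i w = T (coords e (L w)) i.+1.
  rewrite tnth_mktuple linfunE // => a x y.
  by rewrite orth_lift_linear coords_linear (g2sym_linear gT).
have cfE n w : (0 < n < 7)%N -> coords f w n = T (coords e (L w)) n.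
  case: n => // n /= n6; rewrite /coords /=.
  by rewrite -(tnth_nth 0 f (Ordinal (n6 : (n < 6)%N))) fE.
have f_co : is_coframe f.
  apply: coframe_of_inj => // w f0; rewrite -(pi_orth_lift w).
  rewrite (_ : L w = 0) ?linear0 //; apply: g2_metric_eq0.
  have Tw n : (n < 6)%N -> T (coords e (L w)) n.+1 = 0.
    by move=> n6; rewrite -(fE (Ordinal n6)) f0.
  (* As T sends X to e_7, the seventh coordinate is the inner product with X. *)
  have Tw7 : T (coords e (L w)) 7%N = 0.
    rewrite -[RHS](orth_lift_orth w) g2_metricE -(g2sym_dot gT) /dot7.
    by rewrite T1 T2 T3 T4 T5 T6 T7 !mul0r !add0r mul1r.
  rewrite g2_metricE -(g2sym_dot gT) /dot7 Tw7 !Tw //.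
  by rewrite !mul0r !addr0.
have omegaE : su3_omega phi pi X = ewedge f [tuple 1; 2]%N
    + ewedge f [tuple 3; 4]%N + ewedge f [tuple 5; 6]%N.
  apply/funext => w; rewrite !fctE !ewedge2E.
  transitivity (model3 (coords e X) (coords e (L w`_0)) (coords e (L w`_1))).
    case/tupleP: w => x w; case/tupleP: w => y w.
    by rewrite /su3_omega /pullback /Defs.contract g2_phiE.
  (* After T the first argument is e_7, so only the monomials containing 7 survive. *)
  rewrite -(g2sym_model3 gT) /model3 /wedge3 /wedge2 !cfE //.
  by rewrite T1 T2 T3 T4 T5 T6 T7; ring.
have psiE : su3_psi phi pi X = - ewedge f [tuple 2; 4; 6]%N
    + ewedge f [tuple 1; 3; 6]%N + ewedge f [tuple 1; 4; 5]%N
    + ewedge f [tuple 2; 3; 5]%N.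
  apply/funext => w; rewrite su3_psiE !fctE !ewedge3E.
  transitivity (- model4 (coords e X) (coords e (L w`_0)) (coords e (L w`_1))
                         (coords e (L w`_2))).
    case/tupleP: w => x w; case/tupleP: w => y w; case/tupleP: w => z w.
    rewrite -[LHS]/(- g2_star phi [tuple of X :: map_tuple L _]).
    by rewrite g2_starE.
  (* Moving e^7 from the fourth place to the front gives a sign that cancels the minus in the
     definition of psi. *)
  rewrite -(g2sym_model4 gT) /model4 /wedge4 /wedge3 /wedge2 !cfE //.
  rewrite T1 T2 T3 T4 T5 T6 T7.
  ring.
split; last by exists f.
- rewrite omegaE.
  by do ![apply: is_formD|apply: is_formN|apply: is_form_ewedge].
- rewrite psiE.
  by do ![apply: is_formD|apply: is_formN|apply: is_form_ewedge].
Qed.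

Lemma ce_diff_su3_psi (brV : V -> V -> V) (brW : W -> W -> W) :
  is_lie_hom brV brW pi -> lie_central brV X -> g2_coclosed brV phi ->
  ce_diff brW (su3_psi phi pi X) = 0.
Proof.
move=> pi_hom cX coclosed; have [XX kerX] := X_unit.
have fstar := is_form_g2_star.
apply/funext => w; rewrite su3_psiE (ce_diff_pullback (brV := brV)).
  by rewrite ce_diffN fctE ce_diff_contract // opprK coclosed.
move=> x y t; rewrite !fctE /Defs.contract; congr (- _).
(* Both vectors have the same image under [pi], so they differ by a multiple of X, which the X
   already inserted kills. *)
have : L (brW x y) - brV (L x) (L y) \in <[X]>%VS.
  by rewrite kerX memv_ker linearB /= pi_hom !pi_orth_lift subrr.
case/vlineP => c cE.
have -> : L (brW x y) = c *: X + brV (L x) (L y) by rewrite -cE subrK.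
by rewrite form_linear1 // form_alternate01 // mulr0 add0r.
Qed.

End Quotient.

(** By rank-nullity the kernel is a line; any nonzero vector of it is normalised. *)
Lemma g2_unit_kernel_exists (W : vectType R) (pi : 'Hom(V, W)) :
  limg pi = fullv -> \dim {:W} = 6%N -> exists X, g2_unit_kernel phi pi X.
Proof.
move=> pi_onto dimW.
have ker1 : \dim (lker pi) = 1%N.
  have := limg_ker_dim pi fullv; rewrite capfv pi_onto dimW dimV => /eqP.
  by rewrite -[7%N]/(1 + 6)%N eqn_add2r => /eqP.
set Y := vpick (lker pi).
have Y0 : Y != 0 by rewrite vpick0 -dimv_eq0 ker1.
have YY : 0 < g2_metric phi Y Y.
  rewrite lt_neqAle g2_metric_ge0 andbT eq_sym.
  by apply: contra_neq Y0; exact: g2_metric_eq0.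
set r := Num.sqrt (g2_metric phi Y Y).
have r_gt0 : 0 < r by rewrite sqrtr_gt0.
have r_neq0 : r != 0 by rewrite gt_eqF.
exists (r^-1 *: Y); split.
  have metricZ a x y : g2_metric phi x (a *: y) = a * g2_metric phi x y.
    rewrite /g2_metric mulr_sumr; apply: eq_bigr => i _.
    by rewrite linearZ /=; exact: mulrCA.
  rewrite metricZ g2_metricC metricZ -[g2_metric _ _ _]sqr_sqrtr ?ltW // -/r.
  by field.
apply/eqP; rewrite eqEdim ker1 dim_vline scaler_eq0 invr_eq0 negb_or r_neq0 Y0
  andbT.
by rewrite -memvE memvZ // memv_pick.
Qed.

End G2Structure.

(** The unit vector is unique only up to sign, so the conclusion covers every choice, and existence
    is stated alongside. *)
Theorem proposition8 (R : realType)
    (g : vectType R) (brg : g -> g -> g) (Hg : is_lie_bracket brg)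
    (dim_g : \dim {:g} = 7%N)
    (center_g : exists z : g, z != 0 /\ lie_central brg z)
    (phi : 3.-tuple g -> R)
    (Hphi : g2_structure phi) (coclosed_phi : g2_coclosed brg phi)
    (h : vectType R) (brh : h -> h -> h) (Hh : is_lie_bracket brh)
    (dim_h : \dim {:h} = 6%N)
    (pi : 'Hom(g, h)) (pi_hom : is_lie_hom brg brh pi)
    (pi_onto : limg pi = fullv)
    (pi_ker : forall x : g, x \in lker pi -> lie_central brg x) :
  (exists X : g, g2_unit_kernel phi pi X) /\
  (forall X : g, g2_unit_kernel phi pi X ->
     su3_structure (su3_omega phi pi X) (su3_psi phi pi X) /\
     ce_diff brh (su3_psi phi pi X) = 0).
Proof.
split; first exact: g2_unit_kernel_exists.
move=> X X_unit; split; first exact: su3_structure_quotient.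
apply: (ce_diff_su3_psi dim_g Hphi pi_onto X_unit pi_hom) => //.
by apply: pi_ker; case: X_unit => _ <-; exact: memv_line.
Qed.
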